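(* Let $s=p\oplus qr^*$ and $s'=p'\oplus q'r'^*$ be ultimately periodic counters in canonical form, with $r=\nu\delta^{\tau}$, $r'=\nu'\delta^{\tau'}$, and with $T_1$, $T'_1$ the $\delta$-exponents of the first monomials of $q$, $q'$ respectively. Suppose there is no $t\in\mathbb Z$ for which $s(t)=s'(t)\in\{-\infty,+\infty\}$, and that $s\odot^\flat s'$ is defined. Put $$\tau''=\mathrm{lcm}(\tau,\tau'),\qquad \nu''=\tau''\left(\frac{\nu}{\tau}-\frac{\nu'}{\tau'}\right),\qquad t''_{\mathrm p}=\max(T_1,T'_1),$$ and suppose $\nu''>0$. Then the series $s''=s\odot^\flat s'$ is periodic with periodic pattern described by $\tau''$, $\nu''$, $t''_{\mathrm p}$; that is, $$s''(t+k\tau'')=k\nu''+s''(t)\qquad\text{for all integers } t\ge t''_{\mathrm p},\ k\ge0.$$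
   Context: Let $\overline{\mathbb Z}=\mathbb Z\cup\{-\infty,+\infty\}$ with its standard order. A counter is a map $s:\overline{\mathbb Z}\to\overline{\mathbb Z}$ that is non-decreasing for the standard order and satisfies $s(-\infty)=-\infty$, $s(+\infty)=+\infty$; $\Sigma$ is the set of counters. Thus a counter is determined by its values on $\mathbb Z$. The order on $\Sigma$ is $s\preceq s'$ iff $s(t)\ge s'(t)$ (standard order, reversed) for all $t\in\mathbb Z$. Sums $\oplus$ (finite or infinite) of counters are pointwise standard minima (infima) on $\mathbb Z$. The Hadamard product of $s_1,s_2\in\Sigma$ is the counter $s_1\odot s_2$ with $(s_1\odot s_2)(t)=s_1(t)+s_2(t)$ for all $t\in\mathbb Z$, where $(+\infty)+(-\infty)=+\infty$. The monomial $n\delta^{t_0}$ denotes the counter with value $n$ at every $t\in\mathbb Z$ with $t\le t_0$ and $+\infty$ at every $t\in\mathbb Z$ with $t>t_0$. Dual residual: for $a\in\Sigma$ let $\mathcal C_a=\{y\in\Sigma : y(t)=+\infty\text{ for all }t\in\mathbb Z\text{ with }a(t)\in\{-\infty,+\infty\}\}$. For $y\in\mathcal C_a$, $y\odot^\flat a$ denotes the least (for $\preceq$) counter $x\in\Sigma$ such that $a\odot x\succeq y$ (it exists); for $y\notin\mathcal C_a$, $y\odot^\flat a$ is undefined. Ultimately periodic counters: these are counters of the form $s=p\oplus qr^*$ with $p=\bigoplus_{i=1}^{m}n_i\delta^{t_i}$ (transient part, possibly absent, i.e. $m=0$), $q=\bigoplus_{i=1}^{l}N_i\delta^{T_i}$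 (periodic pattern, $l\ge1$), $r=\nu\delta^{\tau}$, with exponents $t_i,T_i\in\mathbb Z$, $\nu\in\mathbb Z$, $\tau\in\mathbb Z$, $\tau\ge 1$; the coefficients and exponents are listed in increasing standard order ($n_1<\dots<n_m<N_1<\dots<N_l$ and $t_1<\dots<t_m<T_1<\dots<T_l$). Here $qr^*=\bigoplus_{k\ge0}\bigoplus_{i=1}^{l}(N_i+k\nu)\delta^{T_i+k\tau}$. In such a representation $T_1$ is the beginning of the periodic regime: $s(t+k\tau)=k\nu+s(t)$ for all integers $t\ge T_1$, $k\ge0$. The representation is in canonical form if $m$ is minimal among all such representations of $s$. The same conventions, with primes, apply to $s'=p'\oplus q'r'^*$. *)

(* Defs.v *)
From HB Require Import structures.
From mathcomp Require Import all_boot all_order all_algebra.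
From mathcomp Require Import boolp classical_sets constructive_ereal.

Set Implicit Arguments.
Unset Strict Implicit.
Unset Printing Implicit Defensive.

Import Order.TTheory GRing.Theory Num.Theory.
Import DualAddTheory.
Local Open Scope classical_set_scope.
Local Open Scope ring_scope.

(* Extended integers are [\bar int].  The addition used throughout is the dual
   one, [(x + y)%dE], for which [+oo + -oo = +oo]. *)

Record counter := Counter {
  counter_fun :> \bar int -> \bar int;
  counter_homo : {homo counter_fun : x y / (x <= y)%O};
  counter_ninfty : counter_fun -oo%E = -oo%E;
  counter_pinfty : counter_fun +oo%E = +oo%E }.

Definition ext_fun (f : int -> \bar int) (x : \bar int) : \bar int :=
  match x with
  | EFin t => f t
  | +oo%E => +oo%E
  | -oo%E => -oo%E
  end.

Lemma ext_fun_homo (f : int -> \bar int) :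
  {homo f : x y / x <= y >-> (x <= y)%O} -> {homo ext_fun f : x y / (x <= y)%O}.
Proof.
move=> hf [x||] [y||] //=; rewrite ?leey ?leNye //.
by rewrite lee_fin; exact: hf.
Qed.

Definition counter_of (f : int -> \bar int)
    (hf : {homo f : x y / x <= y >-> (x <= y)%O}) : counter :=
  Counter (ext_fun_homo hf) erefl erefl.

Lemma counter_ext (s s' : counter) :
  (forall t : int, s t%:E%E = s' t%:E%E) -> s = s'.
Proof.
case: s s' => [f hf fN fP] [g hg gN gP] /= fg.
have {}fg : f = g by apply/funext => -[t||] //; rewrite ?fN ?gN ?fP ?gP.
by subst g; congr Counter; exact: Prop_irrelevance.
Qed.

(* The order on counters is reversed with respect to the pointwise one. *)
Definition cle (s s' : counter) : Prop :=
  forall t : int, (s' t%:E <= s t%:E)%E.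

Lemma infimums_ebar_neq0 (A : set (\bar int)) : infimums A !=set0.
Proof.
have [[z zlb]|nolb] := pselect (exists z : int, lbound A z%:E%E); last first.
  exists -oo%E; split=> [x _|x xlb]; first exact: leNye.
  case: x xlb => [z zlb||//]; first by exfalso; apply: nolb; exists z.
  move=> lbA; exfalso; apply: nolb; exists 0 => y Ay.
  exact: le_trans (leey _) (lbA _ Ay).
have [[u Au]|nofin] := pselect (exists u : int, A u%:E%E); last first.
  exists +oo%E; split=> [x Ax|x _]; last exact: leey.
  case: x Ax => [u Au|//|Ax]; first by exfalso; apply: nofin; exists u.
  by have := zlb _ Ax.
have [n0 nP] : exists n : nat, u = z + n%:Z.
  have uz : 0 <= u - z by rewrite subr_ge0; have := zlb _ Au; rewrite lee_fin.
  exists `|u - z|%N.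
  by rewrite gez0_abs // (addrC z) subrK.
have ex : exists n : nat, `[< A (z + n%:Z)%:E%E >].
  by exists n0; apply/asboolP; rewrite -nP.
case: (ex_minnP ex) => m /asboolP Am mmin.
exists (z + m%:Z)%:E%E; split=> [x Ax|x xlb]; last exact: xlb.
case: x Ax => [v Av|_|Ax]; [|exact: leey|by have := zlb _ Ax].
have vz : 0 <= v - z by rewrite subr_ge0; have := zlb _ Av; rewrite lee_fin.
have ve : v = z + `|v - z|%N%:Z by rewrite gez0_abs // (addrC z) subrK.
by rewrite lee_fin ve lerD2l lez_nat; apply: mmin; apply/asboolP; rewrite -ve.
Qed.

Definition einf (A : set (\bar int)) : \bar int := infimum +oo%E A.

Lemma einf_infimums (A : set (\bar int)) : infimums A (einf A).
Proof.
rewrite /einf /infimum; case: ifPn => [/eqP ->|_].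
  by split=> [//|x _]; exact: leey.
by case: (infimums_ebar_neq0 A) => x Ax; exact: xgetI Ax.
Qed.

Lemma einf_le (A : set (\bar int)) (x : \bar int) : A x -> (einf A <= x)%O.
Proof. by move=> Ax; case: (einf_infimums A) => lbA _; exact: lbA. Qed.

Lemma le_einf (A : set (\bar int)) (x : \bar int) :
  lbound A x -> (x <= einf A)%O.
Proof. by move=> lbA; case: (einf_infimums A) => _; exact. Qed.

Lemma csum_homo (I : Type) (D : set I) (F : I -> counter) :
  {homo (fun t : int => einf [set F i t%:E%E | i in D])
    : x y / x <= y >-> (x <= y)%O}.
Proof.
move=> x y xy; apply: le_einf => _ [i Di <-].
apply: (@le_trans _ _ (F i x%:E%E)); first by apply: einf_le; exists i.
by apply: counter_homo; rewrite lee_fin.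
Qed.

Definition csum (I : Type) (D : set I) (F : I -> counter) : counter :=
  counter_of (csum_homo D F).

Lemma cadd_homo (s s' : counter) :
  {homo (fun t : int => Order.min (s t%:E%E) (s' t%:E%E))
    : x y / x <= y >-> (x <= y)%O}.
Proof.
by move=> x y xy; apply: le_min2; apply: counter_homo; rewrite lee_fin.
Qed.

Definition cadd (s s' : counter) : counter := counter_of (cadd_homo s s').

Lemma hadamard_homo (s s' : counter) :
  {homo (fun t : int => (s t%:E + s' t%:E)%dE) : x y / x <= y >-> (x <= y)%O}.
Proof. by move=> x y xy; apply: lee_dD; apply: counter_homo; rewrite lee_fin. Qed.

Definition hadamard (s s' : counter) : counter :=
  counter_of (hadamard_homo s s').

Lemma monomial_homo (n : \bar int) (t0 : int) :
  {homo (fun t : int => if t <= t0 then n else +oo%E)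
    : x y / x <= y >-> (x <= y)%O}.
Proof.
move=> x y xy; case: ifP => hx; case: ifP => hy //; rewrite ?leey //.
by rewrite (le_trans xy hy) in hx.
Qed.

Definition monomial (n : \bar int) (t0 : int) : counter :=
  counter_of (monomial_homo n t0).

Definition dual_dom (a y : counter) : Prop :=
  forall t : int, a t%:E%E = -oo%E \/ a t%:E%E = +oo%E -> y t%:E%E = +oo%E.

Definition is_dual_residual (y a x : counter) : Prop :=
  cle y (hadamard a x) /\
  forall x' : counter, cle y (hadamard a x') -> cle x x'.

Lemma dual_residual_exists (a y : counter) :
  dual_dom a y -> exists x, is_dual_residual y a x.
Proof.
move=> dom.
pose b (u : int) : \bar int :=
  if a u%:E%E is EFin n then (y u%:E - n%:E)%dE else +oo%E.
pose B t := [set b u | u in [set u | t <= u]].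
have hB : {homo (fun t => einf (B t)) : x z / x <= z >-> (x <= z)%O}.
  move=> x z xz; apply: le_einf => _ [u /= zu <-].
  by apply: einf_le; exists u => //=; exact: le_trans xz zu.
exists (counter_of hB); split=> [t|x' hx' t] /=.
  have le : (einf (B t) <= b t)%O by apply: einf_le; exists t => /=.
  case E: (a t%:E%E) => [n||].
  - move: le; rewrite /b E; case: (y t%:E%E) => [m||].
    + case: (einf _) => [k||] //; first by rewrite !lee_fin lerBrDl.
      by move=> _; exact: leNye.
    + by move=> _; exact: leey.
    + by case: (einf _).
  - by rewrite dom ?leey //; right.
  - by rewrite dom ?leey //; left.
apply: le_einf => _ [u /= tu <-].
apply: (@le_trans _ _ (x' u%:E%E)); first by apply: counter_homo; rewrite lee_fin.
have := hx' u; rewrite /= /b.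
case E: (a u%:E%E) => [n||]; rewrite ?leey //.
case: (y u%:E%E) => [m||]; rewrite ?leey //;
  case: (x' u%:E%E) => [k||] //=; by rewrite ?leNye // !lee_fin lerBrDl.
Qed.

(* The dual residual of y by a; it is defined only for y in the set C_a, whose
   membership predicate is [dual_dom a]. *)
Definition dual_residual (a y : counter) (dom : dual_dom a y) : counter :=
  sval (cid (dual_residual_exists dom)).

Lemma dual_residualP (a y : counter) (dom : dual_dom a y) :
  is_dual_residual y a (dual_residual dom).
Proof. exact: svalP (cid (dual_residual_exists dom)). Qed.

(* The data of an expression p (+) q r^*: a monomial n delta^t is the pair
   (n, t), where n may be infinite, and r = nu delta^tau. *)
Record up_expr := UpExpr {
  transient : seq (\bar int * int);
  pattern : seq (\bar int * int);
  nu : int;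
  tau : int }.

Definition poly_counter (p : seq (\bar int * int)) : counter :=
  csum [set` p] (fun x => monomial x.1 x.2).

Definition periodic_part (E : up_expr) : counter :=
  csum [set: nat] (fun k =>
    csum [set` pattern E] (fun x =>
      monomial (x.1 + (k%:Z * nu E)%:E)%dE (x.2 + k%:Z * tau E))).

Definition up_counter (E : up_expr) : counter :=
  cadd (poly_counter (transient E)) (periodic_part E).

Definition period_start (E : up_expr) : int := (head (0%E, 0) (pattern E)).2.

(* The last clause is not a consequence of the others: for the pattern
   0 delta^0 (+) 1 delta^10 with r = 5 delta^1, the value at 1 is 1, not 5. *)
Definition is_up_repr (s : counter) (E : up_expr) : Prop :=
  [/\ pattern E != [::] /\ 1 <= tau E,
      sorted <%O [seq x.1 | x <- transient E ++ pattern E],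
      sorted <%R [seq x.2 | x <- transient E ++ pattern E],
      s = up_counter E &
      forall (t : int) (k : nat), period_start E <= t ->
        s (t + k%:Z * tau E)%:E%E = ((k%:Z * nu E)%:E + s t%:E)%dE].

Definition is_canonical_repr (s : counter) (E : up_expr) : Prop :=
  is_up_repr s E /\
  forall E', is_up_repr s E' -> (size (transient E) <= size (transient E'))%N.

(* Main.v *)
(** The residual [x] of [y] by [a] satisfies a Galois-type property:
    [z <= x t] if and only if [a u + z <= y u] for all [u >= t].  If a shift by
    [h] adds [c] to [y] and [c'] to [a] on [[t0, +oo[], the right-hand side shows
    that it adds [c - c'] to [x] there; the common period is [h = k tau'']. *)
Require Import Defs.
From mathcomp Require Import all_boot all_order all_algebra.
From mathcomp Require Import boolp classical_sets constructive_ereal.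
From mathcomp Require Import zify ring.

Import Order.TTheory GRing.Theory Num.Theory.
Local Open Scope ring_scope.

Lemma step_homo (z : \bar int) (t : int) :
  {homo (fun u : int => if t <= u then z else -oo%E)
    : x y / x <= y >-> (x <= y)%O}.
Proof.
move=> x y xy; case: ifP => tx; case: ifP => ty; rewrite ?leNye //.
by rewrite (le_trans tx xy) in ty.
Qed.

(** Pointwise the smallest counter whose value at [t] is at least [z]; it serves as a test
    counter. *)
Definition step (z : \bar int) (t : int) : counter :=
  counter_of (step_homo z t).

(** Forward, [x] is non-decreasing, so the bound [z] at [t] persists at every [u >= t]. Backward,
    the condition makes [step z t] a competitor of the residual, and minimality of [x] is read at
    [t]. *)
Lemma le_dual_residual {a y x : counter} {t : int} {z : \bar int} :
  dual_dom a y -> is_dual_residual y a x ->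
  (z <= x t%:E)%E <->
  (forall u : int, t <= u -> (a u%:E + z <= y u%:E)%dE).
Proof.
move=> dom [xP xmin]; split=> [zx u tu|hz].
  apply: le_trans (xP u); apply: DualAddTheoryRealDomain.lee_dD => //.
  by apply: le_trans zx _; apply: counter_homo; rewrite lee_fin.
have /xmin/(_ t) : cle y (hadamard a (step z t)).
  move=> u /=; case: ifP => [/hz //|_].
  (* Here [u < t], so the step is [-oo]. The dual sum is still [+oo] when [a u = +oo], and then
     [dual_dom] forces [y u = +oo]. *)
  case Ea: (a u%:E%E) => [n||] /=; rewrite ?leNye //.
  by rewrite dom //; right.
by rewrite /= lexx.
Qed.

Lemma dual_residual_shift {a y x : counter} {t0 h c c' : int} :
  dual_dom a y -> is_dual_residual y a x ->
  (forall u, t0 <= u -> a (u + h)%:E%E = (c'%:E + a u%:E)%dE) ->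
  (forall u, t0 <= u -> y (u + h)%:E%E = (c%:E + y u%:E)%dE) ->
  forall t, t0 <= t -> x (t + h)%:E%E = ((c - c')%:E + x t%:E)%dE.
Proof.
move=> dom xP ah yh t t0t.
have shiftE z : (z <= x (t + h)%:E)%E <-> ((c' - c)%:E + z <= x t%:E)%dE.
  have shift_le u : t0 <= u -> (a (u + h)%:E + z <= y (u + h)%:E)%dE =
      (a u%:E + ((c' - c)%:E + z) <= y u%:E)%dE.
    move=> t0u; rewrite ah // yh //.
    by case: (a _) (y _) z => [n||] [m||] [k||] //=;
      rewrite ?leey ?leNye ?lee_fin //; lia.
  (* The translation by [h] maps the [u >= t] onto the [u >= t + h]. *)
  rewrite !(le_dual_residual dom xP); split=> hz u tu.
    by rewrite -shift_le ?hz ?lerD2r // (le_trans t0t).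
  rewrite -(subrK h u) shift_le; first by apply: hz; rewrite lerBrDr.
  by rewrite (le_trans t0t) // lerBrDr.
(* The bounds [z] tested are [x (t + h)] itself, then [(c - c') + x t]. *)
apply/le_anti/andP; split.
  have /shiftE := lexx (x (t + h)%:E%E).
  case: (x _) (x t%:E%E) => [m||] [k||] //=; rewrite ?leey ?leNye ?lee_fin //; lia.
apply/shiftE; case: (x _) => [m||] //=; rewrite lee_fin; lia.
Qed.

(** Passing to a multiple of the period lets [s] and [s'] share one. *)
Lemma up_repr_shift {s : counter} {E : up_expr} {t : int} (m k : nat) :
  is_up_repr s E -> period_start E <= t ->
  s (t + k%:Z * (m%:Z * tau E))%:E%E = ((k%:Z * (m%:Z * nu E))%:E + s t%:E)%dE.
Proof. by case=> _ _ _ _ hp ht; rewrite !mulrA -PoszM hp. Qed.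

Theorem proposition3p12 (s s' : counter) (E E' : up_expr)
    (hs : is_canonical_repr s E) (hs' : is_canonical_repr s' E')
    (hinf : ~ exists t : int, s t%:E%E = s' t%:E%E /\
                              (s t%:E%E = -oo%E \/ s t%:E%E = +oo%E))
    (hdef : dual_dom s' s) :
  let s'' := dual_residual hdef in
  let tau'' : int := lcmz (tau E) (tau E') in
  let nu'' : rat :=
    tau''%:~R * ((nu E)%:~R / (tau E)%:~R - (nu E')%:~R / (tau E')%:~R) in
  let tp'' : int := Order.max (period_start E) (period_start E') in
  0 < nu'' ->
  exists2 n : int, n%:~R = nu'' &
    forall (t : int) (k : nat), tp'' <= t ->
      s'' (t + k%:Z * tau'')%:E%E = ((k%:Z * n)%:E + s'' t%:E)%dE.
Proof.
move=> s'' tau'' nu'' tp'' _.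
case: hs hs' => [hE _] [hE' _].
have [[_ tau1] _ _ _ _] := hE; have [[_ tau1'] _ _ _ _] := hE'.
(* The quotient must be a natural number, since [is_up_repr] counts periods in [nat]. *)
have mulP (d : int) : 1 <= d -> (d %| tau'')%Z -> exists m : nat, tau'' = m%:Z * d.
  move=> d1 /dvdzP[q qd]; exists `|q|%N; rewrite gez0_abs //.
  by rewrite -(pmulr_lge0 _ (lt_le_trans ltr01 d1)) -qd.
have [m tauE] := mulP _ tau1 (dvdz_lcml _ _).
have [m' tauE'] := mulP _ tau1' (dvdz_lcmr _ _).
(* As [m = tau'' / tau] and [m' = tau'' / tau'], this is [nu''] expanded. *)
exists (m%:Z * nu E - m'%:Z * nu E').
  have nz (d : int) : 1 <= d -> d%:~R != 0 :> rat.
    by move=> d1; rewrite intr_eq0 gt_eqF // (lt_le_trans _ d1).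
  rewrite /nu'' mulrBr {1}tauE tauE' !intrM intrB !intrM.
  by field; rewrite !nz.
move=> t k tpt; rewrite mulrBr.
apply: (dual_residual_shift hdef (dual_residualP hdef) _ _ _ tpt) => u;
  rewrite ge_max => /andP[hu hu'].
- by rewrite tauE' (up_repr_shift _ _ hE').
- by rewrite tauE (up_repr_shift _ _ hE).
Qed.
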